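(* Let $\mathcal G$ be a connected simple graph on the vertex set $n=\{0,1,\ldots,n-1\}$ with $n\ge 4$, and suppose $\mathcal G$ has two adjacent vertices $x$ and $y$ each of degree $2$. Then $\mathcal G$ is not perm-complete.
   Context: Permutations in $\mathrm{Sym}(n)$ compose left to right. For a finite sequence $\mathbf s$ in $\mathrm{Sym}(n)$, $\bigcirc\mathbf s$ is the composite of its terms in order, $\mathrm{Seq}(\mathbf s)$ the set of its rearrangements and $\mathrm{Prod}(\mathbf s)=\{\bigcirc\mathbf r:\mathbf r\in\mathrm{Seq}(\mathbf s)\}$; $\mathbf s$ is perm-complete iff $\mathrm{Prod}(\mathbf s)$ is $\mathrm{Alt}(n)$ or $\mathrm{Sym}(n)\setminus\mathrm{Alt}(n)$. A simple graph on vertex set $n$ is perm-complete iff it is isomorphic to the graph whose edges are the terms of some perm-complete sequence of pairwise distinct transpositions in $\mathrm{Sym}(n)$ (an edge $(x\,y)$ corresponding to the transposition $(x\,y)$). *)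

(* Defs.v *)
From mathcomp Require Import all_boot all_fingroup all_solvable.

Set Implicit Arguments.
Unset Strict Implicit.
Unset Printing Implicit Defensive.

Section PermSequences.
Variable n : nat.
Implicit Types (s : seq 'S_n) (p : 'S_n).

Local Open Scope group_scope.

(* In 'S_n the product p * q is "first p, then q" (see permM), so this
   composes from left to right. *)
Definition seq_comp s : 'S_n := \prod_(p <- s) p.

(* permutations s enumerates the rearrangements of s (see mem_permutations). *)
Definition Prod s : {set 'S_n} :=
  [set p in [seq seq_comp r | r <- permutations s]].

Definition perm_complete_seq s : Prop :=
  Prod s = 'Alt_('I_n) \/ Prod s = 'Sym_('I_n) :\: 'Alt_('I_n).

(* tperm x x is the identity, hence the condition x != y. *)
Definition transposition p : Prop :=
  exists x y : 'I_n, x != y /\ p = tperm x y.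

Definition graph_of_seq s : rel 'I_n :=
  fun x y => (x != y) && (tperm x y \in s).

End PermSequences.

Section Graphs.
Variable T : finType.
Implicit Types e : rel T.

Definition simple_graph e : Prop := symmetric e /\ irreflexive e.

Definition connected_graph e : Prop := forall x y : T, connect e x y.

Definition degree e (x : T) : nat := #|[set y | e x y]|.

Definition graph_iso e e' : Prop :=
  exists2 f : T -> T, bijective f & forall x y : T, e' (f x) (f y) = e x y.

End Graphs.

Definition perm_complete_graph (n : nat) (e : rel 'I_n) : Prop :=
  exists s : seq 'S_n,
    [/\ uniq s,
        forall p : 'S_n, p \in s -> transposition p,
        perm_complete_seq s
      & graph_iso e (graph_of_seq s)].

(* Main.v *)
Require Import Defs.
From mathcomp Require Import all_boot all_fingroup all_solvable.

(** Let [a] be the other neighbour of [x] and [b] that of [y] (possibly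
    [a = b]).  No rearrangement of the edges has a composite fixing both [x]
    and [y].  Cut the word at [(x y)] as [r1 (x y) r2].  If exactly one of
    [(x a)], [(y b)] lies in [r1], then one of [x], [y] is sent to the other.
    Otherwise one of [r1], [r2] fixes [x] and [y], so the other one has to swap
    them; but the last of [(x a)], [(y b)] takes [y] or [x] out of [{x, y}] and
    nothing brings it back.  Since [n >= 4], there are both even and odd
    permutations fixing [x] and [y]. *)

Local Open Scope group_scope.

Section AdjacentDegreeTwo.

Variable T : finType.
Implicit Types (x y a b : T) (r : seq {perm T}).

Lemma prod_perm_fix {r x} :
  {in r, forall t : {perm T}, t x = x} -> (\prod_(t <- r) t) x = x.
Proof.
move=> fix_r; rewrite big_seq.
by elim/big_ind: _ => [|p q px qx|//]; rewrite ?perm1 // permM px.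
Qed.

(** [y] stays put until [t] sends it to a point other than [x]; the composite of [r2] fixes [x], so
    by injectivity it sends no other point there. *)
Lemma prod_perm_exit r1 r2 (t : {perm T}) x y :
    {in r1, forall u : {perm T}, u y = y} -> t y != x ->
    {in r2, forall u : {perm T}, u x = x} ->
  (\prod_(u <- r1 ++ t :: r2) u) y != x.
Proof.
move=> fix_y ty_x /prod_perm_fix fix_x.
rewrite big_cat big_cons !permM (prod_perm_fix fix_y).
by rewrite -[X in _ != X]fix_x (inj_eq perm_inj).
Qed.

(** Neither [t] nor [u] has to occur in [r], so the property passes to the pieces of a cut word. *)
Definition moved_only_by r x (t u : {perm T}) :=
  {in r, forall v : {perm T}, v x != x -> v = t \/ v = u}.

Lemma moved_only_by_sub {r r' x t u} :
  {subset r' <= r} -> moved_only_by r x t u -> moved_only_by r' x t u.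
Proof. by move=> sub_r' mx v /sub_r'; apply: mx. Qed.

Lemma fixed_of_moved_only_by {r x t u} :
    moved_only_by r x t u -> t \notin r -> u \notin r ->
  {in r, forall v : {perm T}, v x = x}.
Proof.
move=> mx tr ur v vr; apply/eqP/negPn/negP => /(mx v vr) [] def_v.
  by rewrite def_v (negPf tr) in vr.
by rewrite def_v (negPf ur) in vr.
Qed.

Lemma prod_tperm_no_swap r x y a b (e := tperm x y)
    (f := tperm x a) (g := tperm y b) :
    a != y -> b != x -> uniq r -> e \notin r -> f \in r -> g \in r ->
    moved_only_by r x e f -> moved_only_by r y e g ->
  ~ ((\prod_(t <- r) t) x = y /\ (\prod_(t <- r) t) y = x).
Proof.
move=> ay bx Ur er fr gr mx my [rx ry]; move: rx ry.
case/splitPr def_r: r / gr => [r1 r2].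
have [gr1 gr2] : g \notin r1 /\ g \notin r2.
  move: Ur; rewrite def_r cat_uniq /= negb_or => /and3P[_ /andP[gr1 _]].
  by case/andP.
have sub1 : {subset r1 <= r} by move=> t; rewrite def_r mem_cat => ->.
have sub2 : {subset r2 <= r}.
  by move=> t tr2; rewrite def_r mem_cat inE tr2 !orbT.
have e1 : e \notin r1 by apply: contra er => /sub1.
have e2 : e \notin r2 by apply: contra er => /sub2.
have fix1y := fixed_of_moved_only_by (moved_only_by_sub sub1 my) e1 gr1.
have fix2y := fixed_of_moved_only_by (moved_only_by_sub sub2 my) e2 gr2.
(* This decides which of [f], [g] comes later. If it is [g], then [y] leaves for [b] and [r2] fixes
   [x]. *)
have [fr2|fr2] := boolP (f \in r2); last first.
  move=> _ /eqP; apply/negP; apply: prod_perm_exit => //.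
    by rewrite /g tpermL.
  exact: fixed_of_moved_only_by (moved_only_by_sub sub2 mx) e2 fr2.
move=> + _ => /eqP; apply/negP.
case/splitPr def_r2: r2 / fr2 => [r3 r4].
(* Now [f] is the later one. Everything before it, [g] included, fixes [x]; then [f] sends [x] to
   [a], and [r4] fixes [y]. *)
rewrite -cat_cons catA; apply: prod_perm_exit.
- apply: (@fixed_of_moved_only_by _ _ e f).
  + apply: moved_only_by_sub mx => t tr13.
    by rewrite def_r def_r2 -cat_cons catA mem_cat tr13.
  + by apply: contra er; rewrite def_r def_r2 -cat_cons catA !mem_cat => ->.
  + move: Ur; rewrite def_r def_r2 -cat_cons catA cat_uniq /= negb_or.
    by case/and3P=> _ /andP[].
- by rewrite /f tpermL.
- by move=> t tr4; apply: fix2y; rewrite def_r2 mem_cat inE tr4 !orbT.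
Qed.

Lemma prod_tperm_not_fix r x y a b (e := tperm x y)
    (f := tperm x a) (g := tperm y b) :
    x != y -> a != y -> b != x -> uniq r -> e \in r -> f \in r -> g \in r ->
    e != f -> e != g ->
    moved_only_by r x e f -> moved_only_by r y e g ->
  ~ ((\prod_(t <- r) t) x = x /\ (\prod_(t <- r) t) y = y).
Proof.
move=> xy ay bx Ur er fr gr ef eg mx my [].
case/splitPr def_r: r / er => [r1 r2].
have [U1 U2 e1 e2 dis] : [/\ uniq r1, uniq r2, e \notin r1, e \notin r2
    & {in r2, forall t, t \notin r1}].
  move: Ur; rewrite def_r cat_uniq /= negb_or -all_predC.
  by case/and3P=> ? /andP[? /allP ?] /andP[? ?]; split.
have sub1 : {subset r1 <= r} by move=> t; rewrite def_r mem_cat => ->.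
have sub2 : {subset r2 <= r}.
  by move=> t tr2; rewrite def_r mem_cat inE tr2 !orbT.
have mx1 := moved_only_by_sub sub1 mx.
have mx2 := moved_only_by_sub sub2 mx.
have my1 := moved_only_by_sub sub1 my.
have my2 := moved_only_by_sub sub2 my.
(* As [r] has no repetition, each of [f] and [g] lies on exactly one side of [e]. *)
have in12 t : e != t -> t \in r -> (t \in r2) = (t \notin r1).
  move=> et; rewrite def_r mem_cat inE eq_sym (negPf et) /=.
  by case: (boolP (t \in r2)) => [/dis ->|_] //; rewrite orbF => ->.
have := in12 f ef fr; have := in12 g eg gr.
have fix1x := fun h =>
  prod_perm_fix (fixed_of_moved_only_by mx1 e1 h).
have fix1y := fun h =>
  prod_perm_fix (fixed_of_moved_only_by my1 e1 h).
have fix2x := fun h =>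
  prod_perm_fix (fixed_of_moved_only_by mx2 e2 h).
have fix2y := fun h =>
  prod_perm_fix (fixed_of_moved_only_by my2 e2 h).
rewrite big_cat big_cons !permM.
have [f1|f1] := boolP (f \in r1); have [g1|g1] := boolP (g \in r1) => /= g2 f2.
- have /= h2x := fix2x (negbT f2); have /= h2y := fix2y (negbT g2).
  move=> px py; apply: (prod_tperm_no_swap r1 x y a b) => //.
  (* Since [r2] fixes [x] and [y], it can be cancelled; then [r1] has to undo the swap made by
     [e]. *)
  rewrite -[RHS]h2x in px; rewrite -[RHS]h2y in py.
  move: (perm_inj px) (perm_inj py).
  move=> /(canRL (tpermK x y)) + /(canRL (tpermK x y)).
  by rewrite tpermL tpermR.
(* Here [y] is sent to [x]; in the next case [x] is sent to [y]. *)
- rewrite (fix1y g1) tpermR (fix2x (negbT f2)) => _ /eqP.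
  by rewrite (negPf xy).
- rewrite (fix1x f1) tpermL (fix2y (negbT g2)) => /eqP.
  by rewrite eq_sym (negPf xy).
- rewrite (fix1x f1) (fix1y g1) tpermL tpermR => px py.
  exact: (prod_tperm_no_swap r2 x y a b).
Qed.

End AdjacentDegreeTwo.

Lemma degree2_other_neighbor {T : finType} {e : rel T} {x y : T} :
    e x y -> degree e x = 2 ->
  exists2 a, a != y /\ e x a & forall z, e x z -> z = y \/ z = a.
Proof.
move=> exy /eqP/cards2P[u [v [uv def_N]]].
have N z : e x z = (z == u) || (z == v).
  by have /setP/(_ z) := def_N; rewrite !inE.
move: exy; rewrite N => /orP[]/eqP ->.
  exists v; first by rewrite eq_sym N eqxx orbT.
  by move=> z; rewrite N => /orP[]/eqP; [left|right].
exists u; first by rewrite N eqxx.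
by move=> z; rewrite N => /orP[]/eqP; [right|left].
Qed.

Lemma tperm_injr (T : finType) (x : T) : injective (tperm x).
Proof. by move=> y z /permP/(_ x); rewrite !tpermL. Qed.

Lemma tperm_moved (T : finType) (u v x : T) :
  tperm u v x != x -> exists2 w, w != x & tperm u v = tperm x w.
Proof.
case: tpermP => [->|->|_ _]; last by rewrite eqxx.
- by exists v.
- by exists u; rewrite // tpermC.
Qed.

(** A transposition that moves [x] is [tperm x w] for some [w], and its presence in [s] makes [w] a
    neighbour of [x]. *)
Lemma moved_only_by_neighbors (n : nat) (s : seq 'S_n) (x y a : 'I_n) :
    (forall p : 'S_n, p \in s -> transposition p) ->
    (forall z, graph_of_seq s x z -> z = y \/ z = a) ->
  moved_only_by _ s x (tperm x y) (tperm x a).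
Proof.
move=> tr_s nb t ts; have [u [v [_ def_t]]] := tr_s t ts.
rewrite def_t => /tperm_moved[w wx tw]; rewrite tw.
have /nb[->|->] : graph_of_seq s x w; [|by left|by right].
by rewrite /graph_of_seq eq_sym wx -tw -def_t.
Qed.

Lemma perm_complete_seq_fix2 (n : nat) (s : seq 'S_n) (x y : 'I_n) :
    4 <= n -> perm_complete_seq s ->
  exists2 r, perm_eq r s & seq_comp r x = x /\ seq_comp r y = y.
Proof.
move=> n_ge4 s_pc.
suff [p ps [px py]] : exists2 p, p \in Prod s & p x = x /\ p y = y.
  move: ps; rewrite inE => /mapP[r]; rewrite mem_permutations => rs def_p.
  by exists r; rewrite -?def_p.
(* The even witness is the identity; the odd one is a transposition of two points outside [x] and
   [y]. *)
case: s_pc => ->; first by exists 1; rewrite ?group1 ?perm1.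
have : 1 < #|~: [set x; y]|.
  rewrite cardsCs setCK cards2 card_ord ltn_subRL.
  by case: (x != y) => //; apply: ltnW.
case/card_gt1P=> u [v [uxy vxy uv]].
move: uxy vxy; rewrite !inE !negb_or => /andP[ux uy] /andP[vx vy].
exists (tperm u v); last by rewrite !tpermD.
by rewrite in_setD Alt_even odd_tperm uv inE.
Qed.

Theorem theorem2p3 (n : nat) (G : rel 'I_n) (x y : 'I_n)
    (n_ge4 : 4 <= n) (G_simple : simple_graph G) (G_conn : connected_graph G)
    (adj_xy : G x y) (deg_x : degree G x = 2) (deg_y : degree G y = 2) :
  ~ perm_complete_graph G.
Proof.
case=> s [s_uniq s_tr s_pc [h h_bij hG]]; case: G_simple => G_sym G_irr.
have h_inj := bij_inj h_bij; have [k hk kh] := h_bij.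
have adj_yx : G y x by rewrite G_sym.
have [a [ay xa] Nx] := degree2_other_neighbor adj_xy deg_x.
have [b [bx yb] Ny] := degree2_other_neighbor adj_yx deg_y.
have edge u v : G u v -> tperm (h u) (h v) \in s.
  by rewrite -hG => /andP[].
have nb u v c : (forall z, G u z -> z = v \/ z = c) ->
    forall z, graph_of_seq s (h u) z -> z = h v \/ z = h c.
  (* Each vertex is the [h]-image of its [k]-image, so adjacency can be read in [G]. *)
  by move=> N z; rewrite -(kh z) hG => /N[] ->; [left|right].
have [r rs] := perm_complete_seq_fix2 _ _ (h x) (h y) n_ge4 s_pc.
apply: (prod_tperm_not_fix _ _ _ _ (h a) (h b));
  rewrite ?(perm_uniq rs) ?(perm_mem rs) ?edge ?(inj_eq h_inj) //.
- by apply: contraTneq adj_xy => ->; rewrite G_irr.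
- by rewrite (inj_eq (tperm_injr _ _)) (inj_eq h_inj) eq_sym.
- by rewrite tpermC (inj_eq (tperm_injr _ _)) (inj_eq h_inj) eq_sym.
- move=> t; rewrite (perm_mem rs).
  by apply: moved_only_by_neighbors => //; apply: nb.
- move=> t; rewrite (perm_mem rs) [tperm (h x) _]tpermC.
  by apply: moved_only_by_neighbors => //; apply: nb.
Qed.
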